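(* The derivation of an identified tableau is valid; that is: let $\mathbf{T}=(G,\mathcal{G},\mathcal{M},\mathcal{X},\simeq)$ be a valid matroid tableau and let $M_1,M_2\in\{G'\mid G'\text{ is a minor of }G\}\cup\mathcal{G}\cup\mathcal{M}\cup\mathcal{X}$ be such that $M_1$ is a deflate of $M_2$. Then the identified tableau $\mathbf{T}(M_1\simeq M_2)$ is a valid matroid tableau.
   Context: Matroids are pairs $M=(E,\mathcal{I})$ with $E$ a finite ground set. $M|X$ is the restriction of $M$ to $X\subseteq E$, $\mathcal{F}(M)$ is the family of flats of $M$, and $\mathrm{cl}_M$ is the closure operator. Deflate: for a matroid $M=(E,\mathcal{I})$ and $X\subseteq E$, the restriction $M|X$ is a deflate of $M$ if the elements of $E\setminus X$ can be ordered as $e_1,\ldots,e_m$ (pairwise distinct) such that for all $i\in\{1,\ldots,m\}$ the family $C_i=\{F\in\mathcal{F}(M|(X\cup\{e_1,\ldots,e_{i-1}\}))\mid e_i\in\mathrm{cl}_M(F)\}$ has precisely one $\subseteq$-minimal element. A digraph is a pair $D=(V,A)$ with $V$ finite and $A\subseteq V\times V$. A path in $D$ is a non-empty, non-repeating sequence of vertices $p_1p_2\ldots p_n$ with $(p_i,p_{i+1})\in A$ for $1\le i<n$. A routing from $X$ to $Y$ in $D$ is a family $R$ of paths in $D$ such that every $x\in X$ is the first vertex of some $p\in R$, every $p\in R$ ends in a vertex of $Y$, and any two distinct paths of $R$ are vertex-disjoint. For $E,T\subseteq V$, $\Gamma(D,T,E)$ is the matroid on $E$ whose independent sets are those $X\subseteq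 E$ for which there is a routing from $X$ to $T$ in $D$. A matroid $(E,\mathcal{I})$ is a gammoid if it equals $\Gamma(D,T,E)$ for some digraph $D=(V,A)$ with $E\subseteq V$ and some $T\subseteq V$; it is a strict gammoid if such a representation exists with $V=E$. A matroid tableau is a tuple $\mathbf{T}=(G,\mathcal{G},\mathcal{M},\mathcal{X},\simeq)$ where $G$ is a matroid (the goal), $\mathcal{G},\mathcal{M},\mathcal{X}$ are families of matroids, and $\simeq$ is an equivalence relation on $\{G'\mid G'\text{ is a minor of }G\}\cup\mathcal{G}\cup\mathcal{M}\cup\mathcal{X}$. $\mathbf{T}$ is valid if (i) all matroids in $\mathcal{G}$ are gammoids, (ii) no matroid in $\mathcal{M}$ is a strict gammoid, (iii) no matroid in $\mathcal{X}$ is a gammoid, and (iv) every equivalence class of $\simeq$ either consists only of gammoids or contains no gammoid. The identified tableau for $\mathbf{T}$ with respect to $M_1$ and $M_2$ is $\mathbf{T}(M_1\simeq M_2)=(G,\mathcal{G},\mathcal{M},\mathcal{X},\simeq')$, where $\simeq'$ is the smallest equivalence relation such that $M_1\simeq' M_2$ and such that $M'\simeq N'$ implies $M'\simeq' N'$. *)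

(* Defs.v *)
From HB Require Import structures.
From mathcomp Require Import all_boot finmap.

Set Implicit Arguments.
Unset Strict Implicit.
Unset Printing Implicit Defensive.

Local Open Scope fset_scope.

(* Ground sets of matroids and vertex sets of digraphs are finite subsets of a
   common universe K, so that minors are literal minors (not minors up to
   isomorphism) and "E is a subset of V" is literal inclusion.  For [gammoid]
   to be the usual notion, K has to be infinite: a representation may need
   vertices outside of the ground set. *)
Definition infinite_universe (K : choiceType) : Prop :=
  forall S : {fset K}, exists x : K, x \notin S.

Section Matroid.
Context {K : choiceType}.
Implicit Types (E X Y B C F : {fset K}) (I : {fset {fset K}}).

Definition matroid_axioms E I : bool :=
  [&& I `<=` fpowerset E,
      fset0 \in I,
      [forall Y : I, fpowerset (val Y) `<=` I] &
      [forall X : I, forall Y : I,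
         (#|` val X| < #|` val Y|) ==>
         [exists y : val Y `\` val X, val y |` val X \in I]]].

(* The axioms are boolean, hence Leibniz equality of matroids is equality of
   the pairs (E, I). *)
Record matroid : Type := Matroid {
  ground : {fset K};
  indep : {fset {fset K}};
  matroidP : matroid_axioms ground indep
}.

Implicit Types M N : matroid.

Lemma matroid_axiomsP E I :
  reflect [/\ forall X, X \in I -> X `<=` E,
              fset0 \in I,
              forall X Y, Y \in I -> X `<=` Y -> X \in I &
              forall X Y, X \in I -> Y \in I -> #|` X| < #|` Y| ->
                exists2 y, y \in Y `\` X & y |` X \in I]
          (matroid_axioms E I).
Proof.
apply: (iffP and4P) => [[IE I0 /forallP Isub /forallP Iaug]|[IE I0 Isub Iaug]].
  split=> // [X XI|X Y YI XY|X Y XI YI XY].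
  - by rewrite -fpowersetE; apply: (fsubsetP IE).
  - by apply: (fsubsetP (Isub [` YI])); rewrite fpowersetE.
  - have /forallP/(_ [` YI]) := Iaug [` XI].
    by move=> /implyP/(_ XY)/existsP[y yI]; exists (val y) => //; apply: valP.
split=> //.
- by apply/fsubsetP => X XI; rewrite fpowersetE; apply: IE.
- apply/forallP => Y; apply/fsubsetP => X; rewrite fpowersetE.
  by apply: Isub; apply: valP.
- apply/forallP => X; apply/forallP => Y; apply/implyP => XY.
  have [y yYX yI] := Iaug _ _ (valP X) (valP Y) XY.
  by apply/existsP; exists [` yYX].
Qed.

Definition rank M X : nat :=
  \max_(Y <- fpowerset X | Y \in indep M) #|` Y|.

Definition closure M X : {fset K} :=
  [fset e in ground M | rank M (e |` X) == rank M X].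

Definition flats M : {fset {fset K}} :=
  [fset F in fpowerset (ground M) | closure M F == F].

Definition restrict_indep M X : {fset {fset K}} :=
  [fset Y in indep M | Y `<=` X].

Lemma restrictP M X : matroid_axioms (ground M `&` X) (restrict_indep M X).
Proof.
have /matroid_axiomsP[IE I0 Isub Iaug] := matroidP M.
have inR Y : (Y \in restrict_indep M X) = (Y \in indep M) && (Y `<=` X).
  by rewrite !inE.
apply/matroid_axiomsP; split.
- by move=> Y; rewrite inR fsubsetI => /andP[/IE-> ->].
- by rewrite inR I0 fsub0set.
- move=> Y Z; rewrite !inR => /andP[ZI ZX] YZ.
  by rewrite (Isub _ _ ZI YZ) (fsubset_trans YZ ZX).
- move=> Y Z; rewrite !inR => /andP[YI YX] /andP[ZI ZX] YZ.
  have [z zZY zI] := Iaug _ _ YI ZI YZ; exists z => //.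
  rewrite inR zI fsubUset YX fsub1set (fsubsetP ZX) //.
  by move: zZY; rewrite inE => /andP[].
Qed.

(* M|X; ground set X as soon as X is a subset of the ground set of M *)
Definition restrict M X : matroid := Matroid (restrictP M X).

Definition is_basis M C B : bool :=
  [&& B \in indep M, B `<=` C & [forall x : C `\` B, val x |` B \notin indep M]].

Lemma basis_exists M C : exists B, is_basis M C B.
Proof.
have /matroid_axiomsP[_ I0 _ _] := matroidP M.
pose P n := [exists B : indep M, (val B `<=` C) && (#|` val B| == n)].
have Pub n : P n -> n <= #|` C|.
  by case/existsP=> B /andP[BC /eqP<-]; apply: fsubset_leq_card.
have exP : exists n, P n.
  by exists 0; apply/existsP; exists [` I0]; rewrite fsub0set cardfs0 eqxx.
case: (ex_maxnP exP Pub) => n /existsP[B /andP[BC /eqP Bn]] max.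
exists (val B); apply/and3P; split=> //; first exact: valP.
apply/forallP => x; apply/negP => xI.
have /fsetDP[xC xB] := valP x.
suff /max: P n.+1 by rewrite ltnn.
apply/existsP; exists [` xI] => /=.
by rewrite fsubUset BC fsub1set xC cardfsU1 xB Bn add1n eqxx.
Qed.

Lemma basis_card M C B B' :
  is_basis M C B -> is_basis M C B' -> #|` B'| <= #|` B|.
Proof.
have /matroid_axiomsP[_ _ _ Iaug] := matroidP M.
move=> /and3P[BI BC /forallP Bmax] /and3P[BI' BC' _].
rewrite leqNgt; apply/negP => /(Iaug _ _ BI BI')[x /fsetDP[xB' xB] xI].
have xCB : x \in C `\` B by apply/fsetDP; rewrite (fsubsetP BC').
by move: (Bmax [` xCB]); rewrite /= xI.
Qed.

Definition contract_indep M C : {fset {fset K}} :=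
  [fset X in fpowerset (ground M `\` C) |
     [exists B : indep M, is_basis M C (val B) && (val B `|` X \in indep M)]].

Lemma contract_indepP M C X :
  reflect (X `<=` ground M `\` C /\
           exists2 B, is_basis M C B & B `|` X \in indep M)
          (X \in contract_indep M C).
Proof.
rewrite !inE /= fpowersetE; apply: (iffP andP) => -[XE].
  by case/existsP=> B /andP[? ?]; split=> //; exists (val B).
case=> B bB BX; split=> //; have /and3P[BI _ _] := bB.
by apply/existsP; exists [` BI]; rewrite /= bB.
Qed.

Lemma contractP M C : matroid_axioms (ground M `\` C) (contract_indep M C).
Proof.
have /matroid_axiomsP[IE I0 Isub Iaug] := matroidP M.
apply/matroid_axiomsP; split.
- by move=> X /contract_indepP[].
- apply/contract_indepP; split; first exact: fsub0set.
  have [B bB] := basis_exists M C; exists B => //.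
  by rewrite fsetU0; case/and3P: bB.
- move=> X Y /contract_indepP[YE [B bB BY]] XY; apply/contract_indepP.
  split; first exact: fsubset_trans YE.
  by exists B => //; apply: Isub BY _; apply: fsetUS.
- move=> X Y /contract_indepP[XE [B bB BX]] /contract_indepP[YE [B' bB' BY]] XY.
  have cardU A Z : is_basis M C A -> Z `<=` ground M `\` C ->
      #|` A `|` Z| = (#|` A| + #|` Z|)%N.
    move=> /and3P[_ AC _] ZE; rewrite cardfsU.
    suff -> : A `&` Z = fset0 by rewrite cardfs0 subn0.
    apply/fsetP => z; rewrite !inE; apply/negP => /andP[/(fsubsetP AC) zC].
    by move=> /(fsubsetP ZE); rewrite inE zC.
  have lt : #|` B `|` X| < #|` B' `|` Y|.
    rewrite !cardU // -addnS; apply: leq_add => //.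
    exact: (basis_card bB' bB).
  have [z /fsetDP[zB'Y zBX] zI] := Iaug _ _ BX BY lt.
  move: zBX; rewrite in_fsetU negb_or => /andP[zB zX].
  have /and3P[_ _ /forallP Bmax] := bB; have /and3P[_ BC' _] := bB'.
  have zC : z \notin C.
    apply/negP => zC; have zCB : z \in C `\` B by apply/fsetDP.
    move: (Bmax [` zCB]) => /= /negP; apply.
    by apply: Isub zI _; apply: fsetUS; apply: fsubsetUl.
  have zY : z \in Y.
    case/fsetUP: zB'Y => // /(fsubsetP BC') zC'.
    by rewrite zC' in zC.
  exists z; first exact/fsetDP.
  apply/contract_indepP; split.
    by rewrite fsubUset XE fsub1set (fsubsetP YE).
  by exists B => //; rewrite fsetUCA.
Qed.

(* M/C *)
Definition contract M C : matroid := Matroid (contractP M C).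

Definition minor N M : Prop :=
  exists C X, [/\ C `<=` ground M, X `<=` ground M `\` C &
                  N = restrict (contract M C) X].

Definition minimal_in (S : {fset {fset K}}) F : Prop :=
  F \in S /\ forall F', F' \in S -> F' `<=` F -> F' = F.

(* In the last clause, p lists e_1, ..., e_(i-1) and x is e_i. *)
Definition deflate N M : Prop :=
  exists2 X, X `<=` ground M & N = restrict M X /\
  exists e : seq K,
    [/\ uniq e, e =i ground M `\` X &
        forall p x q, e = p ++ x :: q ->
          exists! F, minimal_in
            [fset F' in flats (restrict M (X `|` [fset y in p])) |
               x \in closure M F'] F].

Record digraph : Type := Digraph {
  vertices : {fset K};
  arcs : {fset K * K};
  arcsP : arcs `<=` vertices `*` vertices
}.

Definition is_path (D : digraph) (p : seq K) : bool :=
  [&& p != [::], uniq p, all [in vertices D] p &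
      sorted (fun u v => (u, v) \in arcs D) p].

Definition routing (D : digraph) X Y (R : {fset seq K}) : Prop :=
  [/\ forall p, p \in R -> is_path D p,
      forall x, x \in X -> exists s, x :: s \in R,
      forall x s, x :: s \in R -> last x s \in Y &
      forall p q, p \in R -> q \in R -> p != q -> ~~ has [in p] q].

(* M = Gamma(D, T, E) *)
Definition is_Gamma (D : digraph) (T E : {fset K}) M : Prop :=
  ground M = E /\
  forall X, X \in indep M <-> X `<=` E /\ exists R, routing D X T R.

Definition gammoid M : Prop :=
  exists (D : digraph) (T E : {fset K}),
    [/\ E `<=` vertices D, T `<=` vertices D & is_Gamma D T E M].

Definition strict_gammoid M : Prop :=
  exists (D : digraph) (T : {fset K}),
    T `<=` vertices D /\ is_Gamma D T (vertices D) M.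

End Matroid.

Arguments matroid : clear implicits.
Arguments digraph : clear implicits.

Section Tableau.
Context {K : choiceType}.
Implicit Types (M N : matroid K).

Definition equivalence_on {A : Type} (S : A -> Prop) (r : A -> A -> Prop) : Prop :=
  [/\ forall x y, r x y -> S x /\ S y,
      forall x, S x -> r x x,
      forall x y, r x y -> r y x &
      forall x y z, r x y -> r y z -> r x z].

Definition tableau_carrier (G : matroid K) (GG MM XX : matroid K -> Prop) M : Prop :=
  [\/ minor M G, GG M, MM M | XX M].

Record tableau : Type := Tableau {
  goal : matroid K;
  t_gammoids : matroid K -> Prop;
  t_nonstrict : matroid K -> Prop;
  t_nongammoids : matroid K -> Prop;
  t_eqv : matroid K -> matroid K -> Prop;
  t_eqvP : equivalence_on
             (tableau_carrier goal t_gammoids t_nonstrict t_nongammoids) t_eqv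
}.

Definition carrier (T : tableau) : matroid K -> Prop :=
  tableau_carrier (goal T) (t_gammoids T) (t_nonstrict T) (t_nongammoids T).

Definition valid (T : tableau) : Prop :=
  [/\ forall M, t_gammoids T M -> gammoid M,
      forall M, t_nonstrict T M -> ~ strict_gammoid M,
      forall M, t_nongammoids T M -> ~ gammoid M &
      forall M, carrier T M ->
        (forall N, t_eqv T M N -> gammoid N) \/
        (forall N, t_eqv T M N -> ~ gammoid N)].

(* The smallest equivalence relation on the carrier of T that contains t_eqv T
   and relates M1 and M2, as the intersection of all such relations. *)
Definition identified_eqv (T : tableau) (M1 M2 M N : matroid K) : Prop :=
  forall r : matroid K -> matroid K -> Prop,
    equivalence_on (carrier T) r ->
    r M1 M2 ->
    (forall M' N', t_eqv T M' N' -> r M' N') ->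
    r M N.

Lemma identified_eqvP (T : tableau) (M1 M2 : matroid K) :
  carrier T M1 -> carrier T M2 ->
  equivalence_on (carrier T) (identified_eqv T M1 M2).
Proof.
move=> c1 c2; split.
- move=> M N /(_ (fun M' N' => carrier T M' /\ carrier T N')); apply=> //.
    by split=> [//|//|? ? []|? ? ? [? ?] []].
  by move=> M' N'; case: (t_eqvP T) => sub _ _ _; apply: sub.
- by move=> M cM r [_ rr _ _] _ _; apply: rr.
- move=> M N MN r re r12 rT; have [_ _ rs _] := re.
  by apply: rs; apply: MN.
- move=> M N P MN NP r re r12 rT; have [_ _ _ rt] := re.
  by apply: (rt _ N); [apply: MN | apply: NP].
Qed.

Definition identified (T : tableau) (M1 M2 : matroid K)
    (c1 : carrier T M1) (c2 : carrier T M2) : tableau :=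
  Tableau (identified_eqvP c1 c2).

End Tableau.

Arguments tableau : clear implicits.

(* Main.v *)
From mathcomp Require Import all_boot finmap.
Require Import Defs.

Set Implicit Arguments.
Unset Strict Implicit.
Unset Printing Implicit Defensive.

Local Open Scope fset_scope.

(* Identifying M1 and M2 preserves validity as soon as M1 is a gammoid iff M2
   is one.  Restrictions of gammoids are gammoids.  Conversely, M2 is built from
   its deflate M1 by adding one element at a time, each time by a principal
   extension along some flat F; in a representation of the smaller matroid, the
   new element x becomes a new source with an arc to every vertex of F, after
   renaming the vertex x if it already occurs outside of the ground set. *)

(** * Bases, closure, and one-element extensions of a restriction *)

Section Closure.
Context {K : choiceType}.
Implicit Types (M : matroid K) (X Y B C F A : {fset K}).

Lemma indep_ground M X : X \in indep M -> X `<=` ground M.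
Proof. by case/matroid_axiomsP: (matroidP M) => IE _ _ _; apply: IE. Qed.

Lemma indep_sub M X Y : Y \in indep M -> X `<=` Y -> X \in indep M.
Proof. by case/matroid_axiomsP: (matroidP M) => _ _ Isub _; apply: Isub. Qed.

Lemma in_restrict M A X :
  (X \in indep (restrict M A)) = (X \in indep M) && (X `<=` A).
Proof. by rewrite !inE. Qed.

Lemma is_basisP M C B :
  reflect [/\ B \in indep M, B `<=` C &
              forall x, x \in C -> x \notin B -> x |` B \notin indep M]
          (is_basis M C B).
Proof.
apply: (iffP and3P) => -[BI BC maxB]; split=> //.
  by move=> x xC xB; have xCB : x \in C `\` B; [apply/fsetDP | apply: (forallP maxB [` xCB])].
by apply/forallP => x; have /fsetDP[xC xB] := valP x; apply: maxB.
Qed.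

Lemma basis_indep M B : B \in indep M -> is_basis M B B.
Proof. by move=> BI; apply/is_basisP; split=> // x ->. Qed.

Lemma rank_ge M C Y : Y \in indep M -> Y `<=` C -> #|` Y| <= rank M C.
Proof.
by move=> YI YC; rewrite /rank; apply: leq_bigmax_seq YI; rewrite /= fpowersetE.
Qed.

Lemma basis_rank M C B : is_basis M C B -> rank M C = #|` B|.
Proof.
move=> /is_basisP[BI BC maxB]; apply/eqP; rewrite eqn_leq rank_ge // andbT.
apply/bigmax_leqP_seq => Y; rewrite fpowersetE => YC YI.
have /matroid_axiomsP[_ _ _ Iaug] := matroidP M.
rewrite leqNgt; apply/negP => /(Iaug _ _ BI YI)[y /fsetDP[yY yB]].
by apply/negP/maxB; rewrite // (fsubsetP YC).
Qed.

Lemma basis_extend M C Y : Y \in indep M -> Y `<=` C ->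
  exists2 B, is_basis M C B & Y `<=` B.
Proof.
have [n] := ubnP #|` C `\` Y|; elim: n Y => // n IHn Y leCY YI YC.
case bY: (is_basis M C Y); first by exists Y.
have [x /fsetDP[xC xY] xYI] : exists2 x, x \in C `\` Y & x |` Y \in indep M.
  move/negbT: bY; rewrite /is_basis YI YC /= negb_forall => /existsP[x].
  by rewrite negbK => ?; exists (val x) => //; apply: valP.
have [||B bB /(fsubset_trans (fsubsetU1 _ _)) YB] := IHn (x |` Y) _ xYI.
- rewrite -ltnS; apply: leq_trans leCY; rewrite ltnS; apply: fproper_ltn_card.
  rewrite fproperEneq fsetDS ?fsubsetU1 // andbT.
  by apply/eqP => /fsetP/(_ x); rewrite !inE eqxx xY xC.
- by rewrite fsubUset YC fsub1set xC.
by exists B.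
Qed.

(** If adding [e] to [B] gives no larger independent set, [B] is still a basis after [e] joins [C];
    otherwise the rank grows. From here on a single basis replaces rank computations. *)
Lemma in_closure M C B e : is_basis M C B ->
  (e \in closure M C) =
    (e \in ground M) && ((e \in B) || (e |` B \notin indep M)).
Proof.
move=> bB; have /is_basisP[BI BC maxB] := bB.
rewrite !inE /=; congr (_ && _); rewrite (basis_rank bB).
case: (boolP (_ || _)) => [h|]; last rewrite negb_or negbK => /andP[eB eBI].
  suff /basis_rank-> : is_basis M (e |` C) B by rewrite eqxx.
  apply/is_basisP; split=> //; first exact: fsubset_trans (fsubsetU1 _ _).
  move=> x /fset1UP[->|]; last exact: maxB.
  by move=> /negPf eB; move: h; rewrite eB.
apply/negbTE; rewrite neq_ltn orbC.
by rewrite (leq_trans _ (rank_ge eBI (fsetUS _ BC))) // cardfsU1 eB.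
Qed.

(** A basis of [C] extends to one of [C'], and a dependent set stays dependent when enlarged. *)
Lemma closureS M C C' : C `<=` C' -> closure M C `<=` closure M C'.
Proof.
move=> CC'; have [B bB] := basis_exists M C; have /is_basisP[BI BC _] := bB.
have [B' bB' BB'] := basis_extend BI (fsubset_trans BC CC').
apply/fsubsetP => e; rewrite (in_closure _ bB) (in_closure _ bB').
case/andP=> -> /orP[/(fsubsetP BB')-> //|eBI]; apply/orP; right.
by apply: contra eBI => /indep_sub; apply; apply: fsetUS.
Qed.

Lemma sub_closure M C : C `<=` ground M -> C `<=` closure M C.
Proof.
move=> CE; apply/fsubsetP => e eC; have [B bB] := basis_exists M C.
have /is_basisP[_ _ maxB] := bB.
by rewrite (in_closure _ bB) (fsubsetP CE) //=; case: (boolP (e \in B)) => // /maxB->.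
Qed.

(** A basis of [C] is also a basis of its closure, and the test of [in_closure] mentions only the
    basis. *)
Lemma closureK M C : C `<=` ground M -> closure M (closure M C) = closure M C.
Proof.
move=> CE; have [B bB] := basis_exists M C; have /is_basisP[BI BC _] := bB.
suff bB' : is_basis M (closure M C) B.
  by apply/fsetP => e; rewrite (in_closure _ bB) (in_closure _ bB').
apply/is_basisP; split=> //; first exact: fsubset_trans (sub_closure CE).
by move=> x; rewrite (in_closure _ bB) => /andP[_ /orP[->|]].
Qed.

Lemma indepU1_closure M Y e : Y \in indep M -> e \in ground M -> e \notin Y ->
  (e |` Y \in indep M) = (e \notin closure M Y).
Proof.
by move=> /basis_indep bY eE /negPf eY; rewrite (in_closure _ bY) eE eY negbK.
Qed.

(** A basis of [C] in [M] is one in the restriction too, so the two tests of [in_closure] differ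
    only by membership in [A]. *)
Lemma closure_restrict M A C : C `<=` A ->
  closure (restrict M A) C = closure M C `&` A.
Proof.
move=> CA; have [B bB] := basis_exists M C; have /is_basisP[BI BC maxB] := bB.
have bB' : is_basis (restrict M A) C B.
  apply/is_basisP; rewrite in_restrict BI (fsubset_trans BC) //; split=> // x xC xB.
  by rewrite in_restrict negb_and maxB.
apply/fsetP => e; rewrite in_fsetI (in_closure _ bB) (in_closure _ bB').
rewrite in_restrict in_fsetI fsubUset fsub1set (fsubset_trans BC) // andbT.
by case: (e \in A); rewrite /= ?andbF ?andbT.
Qed.

Lemma in_flats M F : (F \in flats M) = (F `<=` ground M) && (closure M F == F).
Proof. by rewrite -fpowersetE in_fset inE. Qed.

(** When a family has a unique minimal member, this places that member below every other one;
    uniqueness enters the proof in this form. *)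
Lemma minimal_exists (S : {fset {fset K}}) F : F \in S ->
  exists2 F', minimal_in S F' & F' `<=` F.
Proof.
have [n] := ubnP #|` F|; elim: n F => // n IHn F ltFn FS.
case: (boolP [exists F' : S, val F' `<` F]) => [/existsP[F' F'F]|noF].
  have ltF'n : #|` val F'| < n by rewrite (leq_trans (fproper_ltn_card F'F)).
  have [F'' minF'' sF''] := IHn _ ltF'n (valP F').
  by exists F''; rewrite // (fsubset_trans sF'') // fproper_sub.
exists F => //; split=> // F' F'S F'F; apply/eqP; apply: contraNT noF => F'nF.
by apply/existsP; exists [` F'S]; rewrite /= fproperEneq F'nF.
Qed.

(* A modular cut with a unique minimal flat is principal, so M|(x |` A) is the
   principal extension of M|A along F. *)
Lemma principal_extension M A x :
    A `<=` ground M -> x \in ground M -> x \notin A ->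
    (exists! F, minimal_in
       [fset F' in flats (restrict M A) | x \in closure M F'] F) ->
  exists2 F, F `<=` A &
    forall Y, Y `<=` A -> Y \in indep M ->
      x |` Y \in indep M <->
      exists f, [/\ f \in F, f \notin Y & f |` Y \in indep M].
Proof.
move=> AE xE xA [F [minF uniqF]].
have flatP F' : (F' \in [fset F' in flats (restrict M A) | x \in closure M F']) =
    [&& F' `<=` A, closure M F' `&` A == F' & x \in closure M F'].
  rewrite in_fset inE -[X in X && _]/(F' \in flats _) in_flats /= (fsetIidPr AE) -andbA.
  by case: (boolP (F' `<=` A)) => //= F'A; rewrite closure_restrict.
have [] := minF; rewrite flatP => /and3P[FA _ xF] _.
exists F => // Y YA YI.
have xY : x \notin Y by apply: contra xA; apply/fsubsetP.
have YE := fsubset_trans YA AE.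
rewrite indepU1_closure //; split.
  (* If the closure of [Y] contained [F], it would contain the closure of [F] and with it [x]. So
     some [f] of [F] lies outside it. *)
  move=> xclY; have /fsubsetPn[f fF fY] : ~~ (F `<=` closure M Y).
    apply: contra xclY => /(closureS M); rewrite closureK // => /fsubsetP; exact.
  have fE : f \in ground M by rewrite (fsubsetP AE) ?(fsubsetP FA).
  have fnY : f \notin Y by apply: contra fY; apply/fsubsetP/sub_closure.
  by exists f; rewrite indepU1_closure.
move=> [f [fF fnY fYI]]; apply/negP => xclY.
(* The trace on [A] of the closure of [Y] is a flat of the restriction that spans [x]. It therefore
   lies above [F], which puts [f] in the closure of [Y] and contradicts the independence of [Y] with
   [f]. *)
have clYS : closure M Y `&` A \in
    [fset F' in flats (restrict M A) | x \in closure M F'].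
  have YclA : Y `<=` closure M Y `&` A by rewrite fsubsetI sub_closure.
  rewrite flatP fsubsetIr (fsubsetP (closureS M YclA)) // andbT /=.
  rewrite eqEfsubset fsubsetI fsubsetIr andbT.
  rewrite fsetSI ?closureS // andbT fsubIset //.
  by rewrite -[X in _ `<=` X]closureK // closureS // fsubsetIl.
have [F' /uniqF <- /fsubsetP/(_ f fF)] := minimal_exists clYS.
rewrite in_fsetI => /andP[fY _]; move: fYI.
by rewrite indepU1_closure ?fY ?(fsubsetP AE) ?(fsubsetP FA).
Qed.

End Closure.

(** * Routings under renaming of vertices and under addition of a source *)

Section Routing.
Context {K : choiceType}.
Implicit Types (D : digraph K) (X Y T F : {fset K}) (p s : seq K).

Lemma is_path_map (f : K -> K) D D' p :
    injective f ->
    {in vertices D, forall v, f v \in vertices D'} ->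
    (forall u v, (u, v) \in arcs D -> (f u, f v) \in arcs D') ->
  is_path D p -> is_path D' (map f p).
Proof.
move=> fI fV fA /and4P[p0 pU pV pA]; apply/and4P; split.
- by case: p p0 {pU pV pA}.
- by rewrite map_inj_uniq.
- by rewrite all_map; apply/allP => v /(allP pV); apply: fV.
- by rewrite sorted_map; apply: sub_sorted pA => u v; apply: fA.
Qed.

(** Injectivity keeps paths repetition-free and distinct paths disjoint; fixing [X] pointwise keeps
    the required starting vertices. *)
Lemma routing_map (f : K -> K) D D' X T T' R :
    injective f ->
    {in vertices D, forall v, f v \in vertices D'} ->
    (forall u v, (u, v) \in arcs D -> (f u, f v) \in arcs D') ->
    {in X, f =1 id} -> {in T, forall t, f t \in T'} ->
  routing D X T R -> exists R', routing D' X T' R'.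
Proof.
move=> fI fV fA fX fT [Rp RX RT Rd]; exists [fset map f p | p in R]; split.
- by move=> _ /imfsetP[p /= pR ->]; apply: is_path_map (Rp _ pR).
- move=> x xX; have [s sR] := RX _ xX; exists (map f s).
  by apply/imfsetP; exists (x :: s); rewrite //= fX.
- move=> x s /imfsetP[[//|y q] /= qR [-> ->]].
  by rewrite last_map fT // RT.
- move=> _ _ /imfsetP[p /= pR ->] /imfsetP[q /= qR ->] pq.
  have {}pq : p != q by apply: contra pq => /eqP->.
  apply: contra (Rd _ _ pR qR pq) => /hasP[_ /mapP[v vq ->]].
  by rewrite /= mem_map // => vp; apply/hasP; exists v.
Qed.

Lemma rename_arcsP (f : K -> K) D :
  [fset (f a.1, f a.2) | a in arcs D] `<=`
    [fset f v | v in vertices D] `*` [fset f v | v in vertices D].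
Proof.
apply/fsubsetP => _ /imfsetP[[u v] /= /(fsubsetP (arcsP D)) uv ->].
by move: uv; rewrite !in_fsetM /= => /andP[uV vV]; rewrite !in_imfset.
Qed.

Definition rename (f : K -> K) D : digraph K := Digraph (rename_arcsP f D).

(** The heads of the new arcs are cut down to [vertices D], so that the extended digraph makes sense
    for every [F]. *)
Lemma source_arcsP D x F :
  arcs D `|` [fset (x, v) | v in F `&` vertices D] `<=`
    (x |` vertices D) `*` (x |` vertices D).
Proof.
apply/fsubsetP => -[u v] /fsetUP[/(fsubsetP (arcsP D))|/imfsetP[w /= wFV [-> ->]]].
  by rewrite !in_fsetM /= => /andP[uV vV]; rewrite !in_fset1U uV vV !orbT.
rewrite in_fsetM /= !in_fset1U eqxx /=.
by have /fsetIP[_ ->] := wFV; rewrite orbT.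
Qed.

Definition add_source D x F : digraph K := Digraph (source_arcsP D x F).

Lemma in_arcs_source D x F u v :
  ((u, v) \in arcs (add_source D x F)) =
    ((u, v) \in arcs D) || [&& u == x, v \in F & v \in vertices D].
Proof.
rewrite in_fsetU; congr (_ || _); apply/imfsetP/and3P => /=.
  by case=> w /fsetIP[? ?] [-> ->].
by case=> /eqP-> vF vV; exists v => //; apply/fsetIP.
Qed.

(** Every vertex after the first has an incoming arc. The new source has none, so it can only stand
    at the head of a path. *)
Lemma path_mem_source (e : rel K) y s x :
  path e y s -> x \in s -> exists u, e u x.
Proof.
move=> ys /splitPr E; case: E ys => s1 s2.
by rewrite cat_path => /and3P[_ uv _]; exists (last y s1).
Qed.

Section AddSource.
Variables (D : digraph K) (x : K) (F T : {fset K}).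
Hypotheses (xD : x \notin vertices D) (TD : T `<=` vertices D).
Let D' := add_source D x F.

Lemma path_notin p : is_path D p -> x \notin p.
Proof. by case/and4P=> _ _ /allP pV _; apply/negP => /pV; apply/negP. Qed.

(** All new arcs leave [x], so a path avoiding [x] uses only arcs of [D]. *)
Lemma is_path_source p : x \notin p -> is_path D' p = is_path D p.
Proof.
move=> xp; rewrite /is_path; congr [&& _, _, _ & _].
  apply: eq_in_all => v vp; rewrite in_fset1U.
  by case: eqP => // vx; rewrite -vx vp in xp.
apply: (@eq_in_sorted _ (predC1 x)); last first.
  by apply/allP => v vp /=; apply: contraNneq xp => <-.
by move=> u v /negPf /= ux _; rewrite in_arcs_source ux orbF.
Qed.

Lemma source_arc u v : (u, v) \in arcs D' -> v \in vertices D.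
Proof.
rewrite in_arcs_source => /orP[/(fsubsetP (arcsP D))|/and3P[]//].
by rewrite in_fsetM => /andP[].
Qed.

Lemma path_source p : is_path D' p -> x \in p ->
  p = [:: x] \/ exists f s, [/\ p = [:: x, f & s], f \in F & is_path D (f :: s)].
Proof.
case: p => [|y s]; first by case/andP.
move=> D'ys; have /and4P[_ ysU ysV ysA] := D'ys.
have xs : x \notin s.
  by apply/negP => /(path_mem_source ysA)[u /source_arc]; apply/negP.
rewrite inE (negPf xs) orbF => /eqP yx; subst y.
case: s xs ysU ysV ysA {D'ys} => [|f s] xs; first by left.
move=> /= /andP[_ fsU] /andP[_ fsV] /andP[xf fsA]; right; exists f, s; split=> //.
  (* The arc from [x] to [f] is a new one: arcs of [D] start in [vertices D], which does not contain
     [x]. *)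
  move: xf; rewrite in_arcs_source => /orP[/(fsubsetP (arcsP D))|/and3P[]//].
  by rewrite in_fsetM (negPf xD).
by rewrite -is_path_source //; apply/and4P.
Qed.

Lemma routing_source_notin X : x \notin X ->
  (exists R, routing D' X T R) <-> (exists R, routing D X T R).
Proof.
move=> xX; split=> -[R [Rp RX RT Rd]].
  exists [fset p in R | x \notin p]; split.
  - by move=> p; rewrite !inE /= => /andP[/Rp pD' xp]; rewrite -is_path_source.
  - move=> y yX; have [s sR] := RX _ yX; exists s; rewrite !inE /= sR /=.
    apply/negP; have /path_source/[apply] := Rp _ sR.
    by case=> [[yx _]|[f [s' [[yx _] _ _]]]]; rewrite -yx yX in xX.
  - by move=> y s; rewrite !inE => /andP[/RT].
  - by move=> p q; rewrite !inE => /andP[pR _] /andP[qR _]; apply: Rd.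
exists R; split=> // p /Rp pD.
by rewrite is_path_source // path_notin.
Qed.

(** The path serving [x] continues to some [f] in [F]; removing or prepending [x] exchanges the
    roles of [x] and [f] and leaves the other paths alone. *)
Lemma routing_source_in Y : x \notin Y ->
  (exists R, routing D' (x |` Y) T R) <->
  (exists f, [/\ f \in F, f \notin Y & exists R, routing D (f |` Y) T R]).
Proof.
move=> xY; split; last first.
  move=> [f [fF fY [R [Rp RX RT Rd]]]].
  have [s fsR] := RX _ (fset1U1 f Y); have fsD := Rp _ fsR.
  have fD : f \in vertices D by case/and4P: fsD => _ _ /andP[].
  exists ((x :: f :: s) |` (R `\ (f :: s))); split.
  - move=> p /fset1UP[->|/fsetD1P[_ /Rp pD]].
      have fsD' : is_path D' (f :: s) by rewrite is_path_source ?path_notin.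
      have /and4P[_ fsU fsV fsA] := fsD'; apply/and4P; split=> //.
      - by rewrite cons_uniq fsU path_notin.
      - by rewrite /= fset1U1.
      - by apply/andP; split; first by rewrite in_arcs_source eqxx fF fD orbT.
    by rewrite is_path_source ?path_notin.
  - move=> y /fset1UP[->|yY]; first by exists (f :: s); rewrite fset1U1.
    have [s' ys'R] := RX _ (fset1Ur f yY); exists s'.
    apply/fset1UP; right; apply/fsetD1P; split=> //.
    (* The path serving [y] is not the one replaced, because that one starts at [f], outside [Y]. *)
    by apply: contraNneq fY => -[<- _].
  - by move=> y s' /fset1UP[[-> ->]|/fsetD1P[_ /RT //]]; apply: (RT f).
  - have dis q : q \in R `\ (f :: s) -> ~~ has [in x :: f :: s] q.
      move=> /fsetD1P[qfs qR]; have := Rd _ _ fsR qR.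
      rewrite eq_sym => /(_ qfs); apply: contra => /hasP[v vq].
      rewrite inE => /predU1P[vx|vfs]; last by apply/hasP; exists v.
      by move: (path_notin (Rp _ qR)); rewrite -vx vq.
    move=> p q /fset1UP[->|pR] /fset1UP[->|qR] pq.
    - by rewrite eqxx in pq.
    - exact: dis.
    - by rewrite has_sym; apply: dis.
    - by move: pR qR => /fsetD1P[_ pR] /fsetD1P[_ qR]; apply: Rd.
move=> [R [Rp RX RT Rd]]; have [s xsR] := RX _ (fset1U1 x Y).
have [||[f [s' [[Es] fF fsD]]]] := path_source (Rp _ xsR); first exact: mem_head.
  (* A one-vertex path would make [x] a target, but targets lie in [vertices D]. *)
  move=> [Es]; have := RT _ _ xsR; rewrite Es /= => /(fsubsetP TD) xV.
  by have := xD; rewrite xV.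
subst s.
have notin_R p v : p \in R -> p != [:: x, f & s'] -> v \in [:: x, f & s'] -> v \notin p.
  move=> pR pxfs vxfs; apply: contra (Rd _ _ pR xsR pxfs) => vp.
  by apply/hasP; exists v.
have neq_xfs y t : y != x -> y :: t != [:: x, f & s'].
  by move=> yx; apply: contra yx => /eqP[-> _].
have Yx y : y \in Y -> y != x by move=> yY; apply: contraNneq xY => <-.
exists f; split=> //.
  (* A path starting at [f] would be a second path through [f], distinct from the one that leaves
     [x]. *)
  apply/negP => fY; have [t ftR] := RX _ (fset1Ur x fY).
  by have := notin_R _ f ftR (neq_xfs _ _ (Yx _ fY)); rewrite !inE eqxx orbT => /(_ isT).
exists ((f :: s') |` (R `\ [:: x, f & s'])); split.
- move=> p /fset1UP[->//|/fsetD1P[pxfs pR]].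
  by rewrite -is_path_source ?Rp //; apply: notin_R => //; apply: mem_head.
- move=> y /fset1UP[->|yY]; first by exists s'; rewrite fset1U1.
  have [t ytR] := RX _ (fset1Ur x yY); exists t.
  by apply/fset1UP; right; apply/fsetD1P; split=> //; apply/neq_xfs/Yx.
- by move=> y t /fset1UP[[-> ->]|/fsetD1P[_ /RT //]]; apply: (RT x (f :: s')).
- have dis q : q \in R `\ [:: x, f & s'] -> ~~ has [in f :: s'] q.
    move=> /fsetD1P[qxfs qR]; apply/hasPn => v vq; apply/negP => vfs.
    by have := notin_R _ v qR qxfs; rewrite vq inE vfs orbT => /(_ isT).
  move=> p q /fset1UP[->|pR] /fset1UP[->|qR] pq.
  - by rewrite eqxx in pq.
  - exact: dis.
  - by rewrite has_sym; apply: dis.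
  - by move: pR qR => /fsetD1P[_ pR] /fsetD1P[_ qR]; apply: Rd.
Qed.

End AddSource.
End Routing.

(** * Gammoids under restriction, principal extension, deflation and identification *)

Section Gammoid.
Context {K : choiceType}.
Implicit Types (M N : matroid K) (A X Y : {fset K}).

(** Lets the restriction of a matroid to its whole ground set be replaced by the matroid itself. *)
Lemma gammoid_ext M N :
  ground M = ground N -> indep M =i indep N -> gammoid M -> gammoid N.
Proof.
move=> gMN iMN [D [T [E [ED TD [gM iM]]]]]; exists D, T, E; split=> //.
by split=> [|X]; rewrite -?gMN // -iMN.
Qed.

Lemma gammoid_restrict M A : gammoid M -> gammoid (restrict M A).
Proof.
move=> [D [T [E [ED TD [gM iM]]]]]; exists D, T, (E `&` A); split=> //.
  exact: fsubset_trans (fsubsetIl _ _) ED.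
split=> [|X]; first by rewrite /= gM.
rewrite in_restrict fsubsetI; split.
  by case/andP=> /iM[-> ?] ->.
by case=> /andP[XE ->] XR; rewrite andbT; apply/iM.
Qed.

(* Elements outside of the ground set may be vertices of a representation;
   swapping x with a fresh vertex removes x from it. *)
Lemma gammoid_avoid M x : infinite_universe K -> gammoid M -> x \notin ground M ->
  exists D T, [/\ ground M `<=` vertices D, T `<=` vertices D,
                  x \notin vertices D & is_Gamma D T (ground M) M].
Proof.
move=> K_inf [D [T [E [ED TD [gM iM]]]]] xE; subst E; have [w] := K_inf (x |` vertices D).
rewrite in_fset1U negb_or => /andP[wx wD].
(* A transposition is its own inverse: it is injective, and [routing_map] applies to it in both
   directions. *)
pose f y := if y == x then w else if y == w then x else y.
have fK : involutive f.
  move=> y; rewrite /f; have [->|yx] := eqVneq y x; first by rewrite (negPf wx) eqxx.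
  by have [->|/negPf yw] := eqVneq y w; rewrite ?eqxx // (negPf yx) yw.
have fE : {in ground M, f =1 id}.
  move=> y yE; rewrite /f; case: eqP => [yx|_]; first by rewrite -yx yE in xE.
  by case: eqP => // yw; rewrite -yw (fsubsetP ED) in wD.
have fI := inv_inj fK.
have fS X y : (y \in [fset f v | v in X]) = (f y \in X).
  by rewrite -{1}[y]fK mem_imfset.
exists (rename f D), [fset f v | v in T]; split.
- by apply/fsubsetP => y yE; rewrite fS fE // (fsubsetP ED).
- by apply/fsubsetP => y; rewrite !fS; apply: (fsubsetP TD).
- by rewrite fS /f eqxx.
split=> // X; rewrite iM; split=> -[XE [R RR]]; split=> //.
  apply: (routing_map (f := f)) RR => // [v vD|u v uvD|v /(fsubsetP XE)/fE//|v vT].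
  - by rewrite fS fK.
  - by apply/imfsetP; exists (u, v).
  - by rewrite fS fK.
apply: (routing_map (f := f)) RR => // [v|u v|v /(fsubsetP XE)/fE//|v].
- by rewrite fS.
- by case/imfsetP=> -[u' v'] /= uvD [-> ->]; rewrite !fK.
- by rewrite fS.
Qed.

(** [principal_extension] for independence and [routing_source_in] for routings describe the same
    exchange of [x] for some [f] in [F], so adding the source [x] to a representation avoiding [x]
    represents the larger restriction. *)
Lemma gammoid_principal_extension M A x : infinite_universe K ->
    A `<=` ground M -> x \in ground M -> x \notin A ->
    (exists! F, minimal_in
       [fset F' in flats (restrict M A) | x \in closure M F'] F) ->
  gammoid (restrict M A) -> gammoid (restrict M (x |` A)).
Proof.
move=> K_inf AE xE xA /(principal_extension AE xE xA)[F FA extF] gA.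
have gA' : ground (restrict M A) = A by apply/fsetIidPr.
have := gammoid_avoid K_inf gA (x := x).
rewrite gA' => /(_ xA)[D [T [AD TD xD [_ iA]]]].
have iM Y : Y `<=` A -> Y \in indep M <-> exists R, routing D Y T R.
  by move=> YA; have := iA Y; rewrite in_restrict YA andbT => ->; split=> [[]|].
exists (add_source D x F), T, (x |` A); split.
- exact: fsetUS.
- exact: fsubset_trans TD (fsubsetU1 _ _).
split=> [|X]; first by apply/fsetIidPr; rewrite fsubUset fsub1set xE.
rewrite in_restrict; case: (boolP (X `<=` x |` A)) => XA; last first.
  by rewrite andbF; split=> // -[].
rewrite andbT; have [xX|xX] := boolP (x \in X); last first.
  have XA' : X `<=` A.
    apply/fsubsetP => v vX; have /fset1UP[vx|//] := fsubsetP XA _ vX.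
    by rewrite -vx vX in xX.
  by rewrite iM // -(routing_source_notin F T xD xX); split=> [|[]].
have [Y xY defX] : exists2 Y, x \notin Y & X = x |` Y.
  by exists (X `\ x); rewrite ?fsetD1K // !inE eqxx.
have YA : Y `<=` A.
  apply/fsubsetP => v vY; have /fset1UP[vx|//] : v \in x |` A.
    by apply: (fsubsetP XA); rewrite defX fset1Ur.
  by rewrite -vx vY in xY.
have fYA f : f \in F -> f |` Y `<=` A.
  by move=> fF; rewrite fsubUset fsub1set (fsubsetP FA).
have : x |` Y \in indep M <-> exists R, routing (add_source D x F) (x |` Y) T R.
  rewrite (routing_source_in F xD TD xY); split.
    move=> xYI; have YI := indep_sub xYI (fsubsetU1 _ _).
    have [f [fF fY fYI]] := (extF Y YA YI).1 xYI.
    by exists f; split=> //; apply/iM; rewrite ?fYA.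
  move=> [f [fF fY /iM fYI]]; have {}fYI := fYI (fYA f fF).
  apply/extF => //; first exact: indep_sub fYI (fsubsetU1 _ _).
  by exists f.
by rewrite -defX => ->; split=> [|[]].
Qed.

Lemma deflate_gammoid M N : infinite_universe K -> deflate N M ->
  gammoid N <-> gammoid M.
Proof.
move=> K_inf [X XM [-> [e [eU eM ext]]]]; split; last exact: gammoid_restrict.
(* The claim runs over all prefixes of the enumeration, with the suffix [q] kept so that the deflate
   condition applies to each split; the full prefix gives [M]. *)
move=> gX; suff g p q : e = p ++ q -> gammoid (restrict M (X `|` [fset y in p])).
  apply: gammoid_ext (g e [::] (esym (cats0 e))) => [|Y].
    apply/fsetP => y; rewrite !inE /= eM !inE.
    by case: (y \in X); case: (y \in ground M).
  rewrite in_restrict andbC; case: (boolP (Y \in _)) => [YM|]; rewrite ?andbF //.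
  rewrite andbT; apply/fsubsetP => y /(fsubsetP (indep_ground YM)) yM.
  by rewrite !inE /= eM !inE yM andbT orbN.
(* Elements are appended on the right, since the condition on each element refers to those before
   it. *)
elim/last_ind: p q => [|p x IHp] q Ee.
  have -> : [fset y in ([::] : seq K)] = fset0 by apply/fsetP => y; rewrite !inE.
  by rewrite fsetU0.
rewrite cat_rcons in Ee; have [xM xX] : x \in ground M /\ x \notin X.
  by have := eM x; rewrite Ee mem_cat mem_head orbT inE => /esym/andP[].
have xp : x \notin p.
  by move: eU; rewrite Ee cat_uniq => /and3P[_ /hasPn/(_ x (mem_head _ _))].
have -> : X `|` [fset y in rcons p x] = x |` (X `|` [fset y in p]).
  by apply/fsetP => y; rewrite !inE /= mem_rcons inE orbCA.
apply: gammoid_principal_extension (ext _ _ _ Ee) (IHp _ Ee) => //.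
- rewrite fsubUset XM; apply/fsubsetP => y; rewrite !inE /= => yp.
  by have := eM y; rewrite Ee mem_cat yp /= inE => /esym/andP[].
- by rewrite !inE /= negb_or xX.
Qed.

Lemma identified_gammoid (T : tableau K) M1 M2 M N :
    valid T -> carrier T M1 -> carrier T M2 -> (gammoid M1 <-> gammoid M2) ->
  identified_eqv T M1 M2 M N -> (gammoid M <-> gammoid N).
Proof.
(* The smallest equivalence is contained in the relation of being both gammoids or both non-gammoids
   on the carrier. By validity of [T] that relation contains the old one. *)
move=> [_ _ _ T_classes] c1 c2 g12 /(_ (fun M N =>
  [/\ carrier T M, carrier T N & gammoid M <-> gammoid N])).
have [T_sub T_refl T_sym _] := t_eqvP T.
case=> // [|M' N' MN']; first split=> //.
- by move=> ? ? [].
- by move=> ? ? [? ? []].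
- by move=> ? ? ? [? ? gMN] [? ? gNP]; split=> //; apply: iff_trans gNP.
have [cM cN] := T_sub _ _ MN'; split=> //; have MM := T_refl _ cM.
by case: (T_classes _ cM) => gM; split=> g; try exact: gM; case: (gM _ _ g).
Qed.

End Gammoid.

Theorem lemma3p12 (K : choiceType) (K_inf : infinite_universe K)
    (T : tableau K) (T_valid : valid T)
    (M1 M2 : matroid K) (c1 : carrier T M1) (c2 : carrier T M2)
    (M12 : deflate M1 M2) :
  valid (identified c1 c2).
Proof.
have same_gammoid M N := @identified_gammoid K T M1 M2 M N T_valid c1 c2
  (deflate_gammoid K_inf M12).
(* The three families are unchanged, so only the condition on classes remains. *)
have [T_g T_m T_x T_classes] := T_valid; split=> // M cM.
have MM : t_eqv T M M by case: (t_eqvP T) => _ refl _ _; apply: refl.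
(* The old class of [M] decides whether [M] itself is a gammoid, and [same_gammoid] spreads this to
   the whole new class. *)
case: (T_classes _ cM) => /(_ _ MM) gM; [left|right] => N /same_gammoid gMN.
  exact/gMN.
by move/gMN.
Qed.
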